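(* For every integer $d\ge3$ there exist a sequence $(H_i)$ of finite $d$-regular bipartite graphs with $v(H_i)\to\infty$ and a constant $0<c<1$ such that $\gamma_1(H_i)<c^{v(H_i)}$ for every $i$. Furthermore, for every $H_i$ there exists some $p_0=p_0(H_i)\in(0,1)$ such that the derivative of the gap function $g(p)=\lambda_{H_i}(p)-\mathbb{G}_d(p)$ satisfies $g'(p_0)<0$.
   Context: Graphs are finite and simple; $v(G)$ is the number of vertices. A $k$-matching is a set of $k$ pairwise vertex-disjoint edges; $m_k(G)$ is the number of $k$-matchings ($m_0(G)=1$). For $G$ on $v(G)=2n$ vertices write $$M(G,t)=\sum_{k=0}^n m_k(G)t^k=\prod_{k=1}^n(1+\gamma_k(G)t),\qquad\gamma_1(G)\le\dots\le\gamma_n(G)$$ (the $\gamma_k(G)$ are real and non-negative by the Heilmann--Lieb theorem). For $t\ge 0$ let $$p(G,t)=\frac{t\,M'(G,t)}{n\,M(G,t)},\qquad F(G,t)=\frac{\ln M(G,t)}{v(G)}-\frac12\,p(G,t)\ln t$$ (with $F(G,0)=0$). For a $d$-regular bipartite graph $G$ (which has a perfect matching) $t\mapsto p(G,t)$ is a strictly increasing bijection $[0,\infty)\to[0,1)$; let $t(G,p)$ be its inverse and define the entropy function $\lambda_G(p)=F(G,t(G,p))$ for $0\le p<1$ (and $\lambda_G(1)=\lim_{p\nearrow1}\lambda_G(p)$). Moreover, $$\mathbb{G}_d(p)=\frac12\left(p\ln\left(\frac dp\right)+(d-p)\ln\left(1-\frac pd\right)-2(1-p)\ln(1-p)\right).$$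 *)

(* Defs.v *)
From mathcomp Require Import all_boot all_order all_algebra.
From mathcomp Require Import all_classical all_reals all_analysis.

Set Implicit Arguments.
Unset Strict Implicit.
Unset Printing Implicit Defensive.

Import Order.TTheory GRing.Theory Num.Theory.
Import numFieldNormedType.Exports.

Local Open Scope classical_set_scope.
Local Open Scope ring_scope.

Record sgraph := SGraph {
  vertex :> finType;
  adj : rel vertex;
  adj_sym : symmetric adj;
  adj_irrefl : irreflexive adj }.

Section Graphs.
Variable G : sgraph.

Definition nb_vertices : nat := #|{: G}|.

Definition regular (d : nat) : Prop :=
  forall x : G, #|[set y : G | adj x y]%SET| = d.

Definition bipartite : Prop :=
  exists side : G -> bool, forall x y : G, adj x y -> side x != side y.

Definition edges : {set {set G}} :=
  [set e : {set G} | [exists x : G, exists y : G, adj x y && (e == [set x; y]%SET)]]%SET.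

Definition matchings (k : nat) : {set {set {set G}}} :=
  [set S : {set {set G}} |
    [&& S \subset edges, finset.trivIset S & #|S| == k]]%SET.

Definition half_nb_vertices : nat := (nb_vertices)./2.

End Graphs.

Section Matching_polynomial.
Variables (R : realType) (G : sgraph).

Definition match_poly : {poly R} :=
  \poly_(k < (half_nb_vertices G).+1) (#|matchings G k|)%:R.

(* Since match_poly has constant coefficient 1, it determines the sorted
   sequence s: its nonzero terms are the -1/r for r a root (with multiplicity),
   and the size condition fixes the number of zero terms. *)
Definition gammas (s : seq R) : Prop :=
  [/\ size s = half_nb_vertices G, sorted <=%R s &
      match_poly = \prod_(g <- s) (1 + g *: 'X)].

(* deriv is written out because p^`() denotes derive1 here. *)
Definition match_density (t : R) : R :=
  t * (deriv match_poly).[t] / ((half_nb_vertices G)%:R * match_poly.[t]).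

Definition free_entropy (t : R) : R :=
  if t == 0 then 0
  else ln match_poly.[t] / (nb_vertices G)%:R - 2^-1 * match_density t * ln t.

(* Only meaningful where match_density is a bijection from [0, +oo[ onto
   [0, 1[, e.g. for nonempty d-regular bipartite graphs with d > 0. *)
Definition activity (p : R) : R := pinv [set t : R | 0 <= t] match_density p.

Definition entropy (p : R) : R :=
  if p < 1 then free_entropy (activity p)
  else lim (free_entropy (activity q) @[q --> 1^'-]).

End Matching_polynomial.

Definition bethe_entropy (R : realType) (d : nat) (p : R) : R :=
  2^-1 * (p * ln (d%:R / p) + (d%:R - p) * ln (1 - p / d%:R)
          - 2 * (1 - p) * ln (1 - p)).

Definition entropy_gap (R : realType) (G : sgraph) (d : nat) (p : R) : R :=
  entropy G p - bethe_entropy d p.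

(* Main.v *)
Require Import Defs.
From mathcomp Require Import all_classical all_reals all_analysis.
From mathcomp Require Import all_boot all_order all_algebra all_fingroup.
From mathcomp Require Import complex ring lra zify.

(* Perfect matchings of the bipartite double of a digraph are its cycle covers. Take
   a centre through which pass d rings of k blocks, each block a complete digraph on
   d vertices with loops, except that the loop at one vertex is replaced by the two
   ring arcs. A cycle cover has to cover the centre, hence runs through a whole ring;
   if the centre is dropped, each of the k ring vertices returns to its own block, in
   d - 1 ways. So m_n (d - 1)^k <= d m_(n-1), while gamma_1 m_(n-1) <= n m_n as
   the gammas are real and nonnegative (Heilmann-Lieb); gamma_1 is exponentially
   small.
   Moreover the entropy has derivative -1/2 ln t(p), and the gap has derivative
   -1/2 ln (t (1-p)^2 d^2 / (p (d-p))). At t = 4 n^2 <= 1 / gamma_1 the summand of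
   gamma_1 in 1 - p = 1/n sum 1 / (1 + gamma t) gives 1 - p >= 1 / (2n), so that
   t (1-p)^2 >= 1 and the gap decreases. *)

Set Implicit Arguments.
Unset Strict Implicit.
Unset Printing Implicit Defensive.

Import Order.TTheory GRing.Theory Num.Theory.
Import numFieldNormedType.Exports.

Local Open Scope ring_scope.

(** * The Heilmann-Lieb theorem *)

Section MatchingRecursion.
Variable G : sgraph.

Lemma edgesP (e : {set G}) :
  reflect (exists x y, adj x y /\ e = [set x; y]) (e \in edges G).
Proof.
rewrite inE; apply: (iffP existsP) => [[x /existsP [y /andP [xy /eqP ->]]]|].
  by exists x, y.
by move=> [x [y [xy ->]]]; exists x; apply/existsP; exists y; rewrite xy eqxx.
Qed.

Lemma adj_neq (x y : G) : adj x y -> x != y.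
Proof. by apply: contraTneq => ->; rewrite adj_irrefl. Qed.

Lemma mem_edges (x y : G) : adj x y -> [set x; y] \in edges G.
Proof. by move=> xy; apply/edgesP; exists x, y. Qed.

Lemma card_edge (e : {set G}) : e \in edges G -> #|e| = 2.
Proof. by move=> /edgesP [x [y [/adj_neq xy ->]]]; rewrite cards2 xy. Qed.

(** Deleting vertices shrinks A and leaves G fixed, so inductions run over subsets of one type
    instead of over induced subgraphs. *)
Definition matchings_in (A : {set G}) : {set {set {set G}}} :=
  [set S : {set {set G}} | [&& S \subset edges G, trivIset S & cover S \subset A]].

Lemma matchings_inP (A : {set G}) (S : {set {set G}}) :
  reflect [/\ S \subset edges G, trivIset S & cover S \subset A]
          (S \in matchings_in A).
Proof. by rewrite inE; apply: and3P. Qed.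

Lemma set2_inj (v : G) (u w : G) : u != v -> [set v; u] = [set v; w] -> u = w.
Proof.
move=> uv /setP /(_ u); rewrite !inE eqxx (negPf uv) /= => /esym /eqP //.
Qed.

(** Classifies the matchings covering v by the other end of their edge at v; the default v is never
    a neighbour of v. *)
Definition partner (v : G) (S : {set {set G}}) : G :=
  odflt v [pick u | adj v u && ([set v; u] \in S)].

Lemma partnerP (S : {set {set G}}) (v u : G) :
  S \subset edges G -> trivIset S -> adj v u -> v \in cover S ->
  (partner v S == u) = ([set v; u] \in S).
Proof.
move=> sSE tS vu vS; rewrite /partner.
have ex w : v \in [set v; w] by rewrite !inE eqxx.
case: pickP => [w /andP [vw wS]|none] /=.
  apply/eqP/idP => [<- //|uS].
  apply: (@set2_inj v); first by rewrite eq_sym adj_neq.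
  by rewrite -(def_pblock tS wS (ex _)) (def_pblock tS uS (ex _)).
move: vS => /bigcupP [e eS ve].
have /edgesP [x [y [xy exy]]] := subsetP sSE _ eS.
move: ve; rewrite exy !inE => /orP [] /eqP vE.
  by have := none y; rewrite vE xy -exy eS.
by have := none x; rewrite vE adj_sym xy finset.setUC -exy eS.
Qed.

(** Together with [matchings_inD1], this makes adding and removing the edge vu inverse bijections
    between the matchings of A without v, u and those of A that contain vu. *)
Lemma matchings_inU1 (A : {set G}) (v u : G) (S : {set {set G}}) :
  v \in A -> u \in A -> adj v u ->
  S \in matchings_in (A :\ v :\ u) ->
  [/\ [set v; u] |: S \in matchings_in A, v \in cover ([set v; u] |: S) &
      [set v; u] \notin S].
Proof.
move=> vA uA vu /matchings_inP [sSE tS cS].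
have dis : {in S, forall B : {set G}, [disjoint [set v; u] & B]}.
  move=> B BS; have sB : B \subset A :\ v :\ u.
    by apply: subset_trans cS; apply: bigcup_sup.
  apply/pred0P => z /=; apply/negP => /andP [zvu /(subsetP sB)].
  by move: zvu; rewrite !inE => /orP [] /eqP ->; rewrite eqxx ?andbF.
have n0 : set0 \notin S.
  by apply/negP => /(subsetP sSE) /card_edge; rewrite cards0.
have [tU nS] := trivIsetU1 dis tS n0.
split=> //; last first.
  by apply/bigcupP; exists [set v; u]; rewrite !inE eqxx.
apply/matchings_inP; split => //.
  by rewrite subUset sub1set mem_edges.
rewrite /cover bigcup_setU big_set1 subUset; apply/andP; split.
  by apply/subsetP => z; rewrite !inE => /orP [] /eqP ->.
by apply: subset_trans cS _; apply/subsetP => z; rewrite !inE => /and3P [].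
Qed.

Lemma matchings_inD1 (A : {set G}) (v u : G) (S : {set {set G}}) :
  adj v u -> S \in matchings_in A -> [set v; u] \in S ->
  S :\ [set v; u] \in matchings_in (A :\ v :\ u).
Proof.
move=> vu /matchings_inP [sSE tS cS] eS; apply/matchings_inP; split.
- by apply: subset_trans (subsetDl _ _) sSE.
- exact: trivIsetD.
rewrite coverD1 //; apply/subsetP => z; rewrite !inE => /andP [].
by rewrite negb_or => /andP [-> ->] /(subsetP cS) ->.
Qed.

Variable C : comNzRingType.

Definition matching_sum (t : C) (A : {set G}) : C :=
  \sum_(S in matchings_in A) t ^+ #|S|.

(** Either v is uncovered, or the edge joining it to its partner u is removed at the cost of a
    factor t. *)
Lemma matching_sum_rec (t : C) (A : {set G}) (v : G) : v \in A ->
  matching_sum t A = matching_sum t (A :\ v) +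
    t * \sum_(u in A :\ v | adj v u) matching_sum t (A :\ v :\ u).
Proof.
move=> vA; rewrite /matching_sum (bigID (fun S => v \in cover S)) /= addrC.
congr (_ + _).
  apply: eq_bigl => S; rewrite !inE subsetD1.
  by case: (S \subset _); case: (trivIset S).
rewrite (partition_big (partner v) (fun u => (u \in A :\ v) && adj v u)) /=.
  rewrite mulr_sumr; apply: eq_bigr => u /andP [uAv vu].
  have uA : u \in A by move: uAv; rewrite !inE => /andP [].
  rewrite mulr_sumr.
  rewrite (reindex_onto (fun S => [set v; u] |: S) (fun S => S :\ [set v; u])) /=.
    apply: eq_big => [S|S /andP [_ /eqP nS]].
      apply/idP/idP => [/andP [/andP [/andP [SM vS] pS] /eqP nS]|SM].
        rewrite -nS; apply: matchings_inD1 => //.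
        by rewrite !inE eqxx.
      have [SUM vS nS] := matchings_inU1 vA uA vu SM.
      have /matchings_inP [sSE tS _] := SUM.
      by rewrite SUM vS partnerP // setU1K // setU11 eqxx.
    rewrite cardsU1 exprD; suff -> : [set v; u] \notin S by rewrite expr1.
    by rewrite -nS !inE eqxx.
  move=> S /andP [/andP [/matchings_inP [sSE tS _] vS]].
  by rewrite partnerP // => eS; rewrite setD1K.
move=> S /andP [/matchings_inP [sSE tS cS] vS].
move: (vS) => /bigcupP [e eS ve].
have /edgesP [x [y [xy exy]]] := subsetP sSE _ eS.
have [u vu eE] : exists2 u, adj v u & e = [set v; u].
  move: ve; rewrite exy !inE => /orP [] /eqP vE; first by exists y; rewrite vE.
  by exists x; [rewrite vE adj_sym|rewrite vE finset.setUC].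
have /eqP -> : partner v S == u by rewrite partnerP // -eE.
rewrite vu andbT !inE eq_sym adj_neq //=; apply: (subsetP cS).
by apply/bigcupP; exists e => //; rewrite eE !inE eqxx orbT.
Qed.

Lemma matching_sum0 (t : C) : matching_sum t set0 = 1.
Proof.
rewrite /matching_sum (big_pred1 set0) ?cards0 ?expr0 // => S; rewrite !inE.
apply/idP/eqP => [/and3P [sSE _]|->]; last first.
  by rewrite sub0set /cover big_set0 sub0set andbT; apply/trivIsetP => B D; rewrite inE.
rewrite subset0 => /eqP cS; apply/setP => e; rewrite inE; apply/negP => eS.
have : e \subset cover S by apply: bigcup_sup.
rewrite cS subset0 => /eqP e0.
by have := card_edge (subsetP sSE _ eS); rewrite e0 cards0.
Qed.

Lemma card_matching (A : {set G}) (S : {set {set G}}) :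
  S \in matchings_in A -> (#|S|.*2 <= #|A|)%N.
Proof.
move=> /matchings_inP [sSE /eqP tS /subset_leq_card]; apply: leq_trans.
rewrite -tS (eq_bigr (fun=> 2)) => [|e /(subsetP sSE) /card_edge //].
by rewrite sum_nat_const muln2.
Qed.

Lemma sum_by_card (t : C) (n : nat) (P : pred {set {set G}}) :
  (forall S, P S -> (#|S| <= n)%N) ->
  \sum_(S | P S) t ^+ #|S| = \sum_(k < n.+1) (#|[set S : {set {set G}} | P S & #|S| == k]|)%:R * t ^+ k.
Proof.
move=> HP; rewrite (partition_big (fun S : {set {set G}} => inord #|S| : 'I_n.+1) xpredT) //=.
apply: eq_bigr => k _; rewrite -sum1_card natr_sum mulr_suml.
apply: eq_big => [S|S /andP [PS /eqP <-]]; last by rewrite mul1r inordK // ltnS HP.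
rewrite inE; have [PS/=|//] := boolP (P S).
by rewrite -val_eqE /= inordK // ltnS HP.
Qed.

End MatchingRecursion.

(** * Real-rootedness of the matching polynomial *)

Section HeilmannLieb.
Variables (R : realType) (G : sgraph).
Local Notation C := (complex R).
Local Open Scope complex_scope.

Lemma Im_inv_lt0 (z : C) : 0 < complex.Im z -> complex.Im z^-1 < 0.
Proof.
case: z => a b /= b0; rewrite oppr_lt0 divr_gt0 //.
by rewrite ltr_wpDl ?sqr_ge0 // exprn_gt0.
Qed.

(* Writing Q_A for the matching sum at -1/x^2, the ratios r_v = x Q_A / Q_(A - v)
   satisfy r_v = x - sum_u 1/r_u, so they stay in the upper half plane. *)
Lemma matching_sum_neq0 (x : C) (A : {set G}) : 0 < complex.Im x ->
  matching_sum (- x ^- 2) A != 0 /\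
  (forall v, v \in A -> 0 <
     complex.Im (x * matching_sum (- x ^- 2) A / matching_sum (- x ^- 2) (A :\ v))).
Proof.
move=> x0; have xn0 : x != 0 by apply: contraTneq x0 => ->; rewrite ltxx.
set t := - _; set Q := matching_sum t.
move: {2}#|A| (leqnn #|A|) => n; elim: n => [|n IH] in A *.
  rewrite leqn0 cards_eq0 => /eqP ->; split; first by rewrite /Q matching_sum0 oner_neq0.
  by move=> v; rewrite inE.
move=> An.
have main v : v \in A -> 0 < complex.Im (x * Q A / Q (A :\ v)).
  move=> vA; have Avn : (#|A :\ v| <= n)%N by rewrite -ltnS (leq_trans _ An) // [in ltnRHS](cardsD1 v) vA.
  have [Q0 HQ] := IH _ Avn.
  rewrite /Q (matching_sum_rec _ vA) -/Q.
  have -> : x * (Q (A :\ v) + t * \sum_(u in A :\ v | adj v u) Q (A :\ v :\ u)) / Q (A :\ v)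
     = x - \sum_(u in A :\ v | adj v u) (x * Q (A :\ v) / Q (A :\ v :\ u))^-1.
    rewrite mulrDr mulrDl mulfK //; congr (_ + _).
    have xt : x * t = - x^-1 by rewrite /t mulrN expr2 invfM mulrA mulfV ?mul1r.
    rewrite mulrA xt -mulrA mulNr mulrC mulr_suml; congr (- _).
    rewrite mulr_suml; apply: eq_bigr => u _.
    by rewrite invf_div [x * _]mulrC invfM mulrA mulrAC.
  have -> y z : complex.Im (y - z) = complex.Im y - complex.Im z by case: y; case: z.
  rewrite subr_gt0; apply: le_lt_trans x0.
  have -> (P : pred G) (F : G -> C) : complex.Im (\sum_(u | P u) F u) = \sum_(u | P u) complex.Im (F u).
    by apply: (big_morph (@complex.Im R)) => // -[? ?] [? ?].
  apply: sumr_le0 => u /andP [uAv _]; apply/ltW/Im_inv_lt0.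
  exact: HQ.
(* If Q A vanished, so would the ratio at any v in A, contradicting its positive imaginary part. *)
split=> //; have [->|[v vA]] := set_0Vmem A; first by rewrite /Q matching_sum0 oner_neq0.
by apply: contraTneq (main v vA) => ->; rewrite mulr0 mul0r ltxx.
Qed.

Local Notation toC := (real_complex R).

Lemma match_poly_complexE (t : C) :
  (map_poly toC (match_poly R G)).[t] = matching_sum t [set: G].
Proof.
rewrite /matching_sum (@sum_by_card _ _ _ (half_nb_vertices G)); last first.
  move=> S /card_matching; rewrite cardsT /half_nb_vertices /nb_vertices => h.
  by rewrite -(doubleK #|S|) half_leq.
rewrite /match_poly horner_coef.
set p := map_poly _ _; have sp : (size p <= (half_nb_vertices G).+1)%N.
  by rewrite size_map_poly size_poly.
rewrite (big_ord_widen _ (fun i => p`_i * t ^+ i) sp) big_mkcond /=.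
apply: eq_bigr => k _; have -> : #|[set S : {set {set G}} | (S \in matchings_in [set: G]) & #|S| == k]| = #|matchings G k|.
  by apply: eq_card => S; rewrite !inE finset.subsetT andbT andbA.
rewrite coef_map coef_poly ltn_ord /= rmorph_nat.
case: ltnP => // /leq_sizeP /(_ k (leqnn k)).
by rewrite coef_map coef_poly ltn_ord /= rmorph_nat => ->; rewrite mul0r.
Qed.

(** With y a square root of -1/z one has z = -1/y^2. A non-real y is excluded by
    [matching_sum_neq0], so -1/z = y^2 is the square of a real number. *)
Lemma match_poly_root (z : C) : root (map_poly toC (match_poly R G)) z ->
  exists2 g : R, 0 <= g & - z^-1 = toC g.
Proof.
rewrite rootE match_poly_complexE => Qz.
pose y := sqrtc (- z^-1).
have y2 : y ^+ 2 = - z^-1 by rewrite sqr_sqrtc.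
have zE x : x ^+ 2 = - z^-1 -> z = - x ^- 2 by move=> ->; rewrite invrN invrK opprK.
have [Imy|Imy] := eqVneq (complex.Im y) 0.
  exists (complex.Re y ^+ 2); first exact: sqr_ge0.
  rewrite -y2 rmorphXn /=; congr (_ ^+ 2).
  by case: (y) Imy => a b /= ->.
exfalso.
(* One of y and -y lies in the upper half plane. *)
have [x x2 x0] : exists2 x : C, x ^+ 2 = - z^-1 & 0 < complex.Im x.
  have [Iy|Iy|Iy] := ltgtP (complex.Im y) 0; last by rewrite Iy eqxx in Imy.
    exists (- y); first by rewrite sqrrN.
    by case: (y) Iy => a b /=; rewrite oppr_gt0.
  by exists y.
have [] := matching_sum_neq0 [set: G] x0.
by rewrite -zE // Qz.
Qed.

Lemma Heilmann_Lieb : exists2 s : seq R, gammas G s & all (>= 0) s.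
Proof.
set M := match_poly R G.
have M0 : M`_0 = 1.
  rewrite coef_poly /=; suff -> : matchings G 0 = [set set0] by rewrite cards1.
  apply/setP => S; rewrite !inE cards_eq0 andbA andb_idl // => /eqP ->.
  by rewrite sub0set; apply/trivIsetP => B D; rewrite inE.
have [r Hr] := closed_field_poly_normal (map_poly toC M).
have Mn0 : M != 0 by apply: contra_eq_neq M0 => ->; rewrite coef0 eq_sym oner_neq0.
have lc0 : lead_coef (map_poly toC M) != 0.
  by rewrite lead_coef_eq0 map_poly_eq0.
have rroot z : z \in r -> root (map_poly toC M) z.
  by move=> zr; rewrite Hr rootZ // root_prod_XsubC.
pose gam (z : C) := complex.Re (- z^-1).
have gamE z : z \in r -> toC (gam z) = - z^-1 /\ 0 <= gam z.
  by move=> /rroot /match_poly_root [g g0 gE]; rewrite /gam gE.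
have rn0 z : z \in r -> z != 0.
  move=> /rroot; apply: contraTneq => ->.
  by rewrite rootE horner_coef0 coef_map M0 oner_neq0.
have ME : M = \prod_(g <- map gam r) (1 + g *: 'X).
  apply: (@map_inj_poly _ _ toC); [exact: fmorph_inj|exact: rmorph0|].
  rewrite rmorph_prod big_map /=.
  have -> : \prod_(z <- r) map_poly toC (1 + gam z *: 'X) =
            (\prod_(z <- r) (- z^-1)) *: \prod_(z <- r) ('X - z%:P).
    rewrite -scaler_prod big_seq [RHS]big_seq; apply: eq_bigr => z zr.
    have [gz _] := gamE _ zr.
    rewrite rmorphD rmorph1 -mul_polyC rmorphM /= map_polyC map_polyX /= gz.
    by rewrite scalerBr -!mul_polyC -polyCM mulNr mulVf ?rn0 // !polyCN polyC1 opprK addrC.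
  rewrite [LHS]Hr; congr (_ *: _).
  (* The constant coefficient 1 determines the leading coefficient of the factorization. *)
  have := congr1 (fun p => p.[0]) Hr.
  rewrite /= hornerZ horner_coef0 coef_map M0 /= rmorph1 horner_prod => E1.
  apply: (mulIf (_ : \prod_(z <- r) ('X - z%:P).[0] != 0)).
    by apply/eqP => E0; move: E1; rewrite E0 mulr0 => /eqP; rewrite oner_eq0.
  rewrite -E1 -big_split /= big_seq big1 // => z zr.
  by rewrite !hornerE mulrNN mulVf ?rn0.
have szr : (size r <= half_nb_vertices G)%N.
  rewrite -ltnS -(size_prod_XsubC r id) -(size_scale _ lc0) -Hr size_map_poly.
  exact: size_poly.
(* Without a perfect matching the degree is below n; the missing gammas are zeros. *)
pose l := nseq (half_nb_vertices G - size r) 0 ++ map gam r.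
have l0 : all (>= 0) l.
  rewrite all_cat all_nseq lexx orbT /=; apply/allP => _ /mapP [z zr ->].
  by have [] := gamE _ zr.
exists (sort <=%R l); last by rewrite all_sort.
split; first by rewrite size_sort size_cat size_nseq size_map subnK.
  exact: sort_le_sorted.
rewrite -/M ME (perm_big _ (permEl (perm_sort _ _))) big_cat /=.
by rewrite [X in _ = X * _]big1_seq ?mul1r // => g /andP [_ /nseqP [-> _]]; rewrite scale0r addr0.
Qed.

End HeilmannLieb.

Local Close Scope ring_scope.

(** * Matchings of the ring graphs *)

Section DoubleCover.
Variables (T : finType) (E : rel T).

(* [(false, x)] is adjacent to [(true, y)] when [E x y]; hence perfect matchings
   are the permutations s with [E x (s x)] for all x. *)
Definition cover_adj : rel (bool * T) :=
  fun u v => (u.1 != v.1) && (if u.1 then E v.2 u.2 else E u.2 v.2).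

Lemma cover_adj_sym : symmetric cover_adj.
Proof. by move=> [[] x] [[] y]. Qed.

Lemma cover_adj_irrefl : irreflexive cover_adj.
Proof. by move=> [[] x]. Qed.

Definition double_cover : sgraph := SGraph cover_adj_sym cover_adj_irrefl.

Lemma nb_vertices_double_cover : nb_vertices double_cover = #|T|.*2.
Proof. by rewrite /nb_vertices card_prod card_bool mul2n. Qed.

Lemma half_nb_vertices_double_cover : half_nb_vertices double_cover = #|T|.
Proof. by rewrite /half_nb_vertices nb_vertices_double_cover doubleK. Qed.

Lemma bipartite_double_cover : bipartite double_cover.
Proof. by exists (fun u => u.1) => u v /andP []. Qed.

Lemma regular_double_cover (d : nat) :
  (forall x, #|[set y | E x y]| = d) -> (forall y, #|[set x | E x y]| = d) ->
  regular double_cover d.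
Proof.
move=> dout din [b x].
have inj_pair (c : bool) : injective (fun y : T => (c, y)) by move=> y z [].
case: b.
  rewrite -(din x) -(card_imset _ (inj_pair false)); apply: eq_card => -[c y].
  rewrite inE; apply/idP/imsetP => [|[z]]; last by rewrite inE => zx [-> ->].
  by case: c => // xy; exists y => //; rewrite inE.
rewrite -(dout x) -(card_imset _ (inj_pair true)); apply: eq_card => -[c y].
rewrite inE; apply/idP/imsetP => [|[z]]; last by rewrite inE => zx [-> ->].
by case: c => // xy; exists y => //; rewrite inE.
Qed.

Definition link (s : {perm T}) (x : T) : {set double_cover} :=
  [set (false, x); (true, s x)].

Lemma mem_linkF s x y : ((false, y) \in link s x) = (y == x).
Proof. by rewrite !inE /= orbF. Qed.

Lemma mem_linkT s x y : ((true, y) \in link s x) = (y == s x).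
Proof. by rewrite !inE. Qed.

Lemma link_inj s : injective (link s).
Proof. by move=> x y /setP /(_ (false, x)); rewrite !mem_linkF eqxx => /esym /eqP. Qed.

Lemma links_matching (s : {perm T}) (D : {set T}) : {in D, forall x, E x (s x)} ->
  link s @: D \in matchings double_cover #|D|.
Proof.
move=> DE; rewrite inE card_imset; last exact: link_inj.
rewrite eqxx andbT; apply/andP; split.
  by apply/subsetP => _ /imsetP [x xD ->]; apply: mem_edges; apply: DE.
apply/trivIsetP => _ _ /imsetP [x _ ->] /imsetP [y _ ->] xy.
apply/pred0P => -[[] z] /=; apply: contraNF xy.
  by rewrite !mem_linkT => /andP [/eqP -> /eqP /perm_inj ->].
by rewrite !mem_linkF => /andP [/eqP -> /eqP ->].
Qed.

Definition compatible : {set {perm T}} := [set s : {perm T} | [forall x, E x (s x)]].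

(* Near-perfect matchings missing both copies of v: the pair (v, v) of such a
   permutation need not be an arc. *)
Definition compatible_off (v : T) : {set {perm T}} :=
  [set s : {perm T} | (s v == v) && [forall x, (x != v) ==> E x (s x)]].

(** As many disjoint edges as elements of T cover all the vertices. So every false copy has a true
    partner, and partners are distinct because a true copy lies in only one edge. *)
Lemma perfect_matching_links (S : {set {set double_cover}}) :
  S \in matchings double_cover #|T| ->
  exists2 s, s \in compatible & S = link s @: setT.
Proof.
rewrite inE => /and3P [sSE tS /eqP cS].
have covS : cover S = setT.
  apply/eqP; rewrite eqEcard finset.subsetT cardsT /= -/(nb_vertices double_cover).
  rewrite nb_vertices_double_cover -(eqP tS).
  rewrite (eq_bigr (fun=> 2)) => [|e /(subsetP sSE) /card_edge //].
  by rewrite sum_nat_const muln2 cS.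
have ex x : exists y, ([set (false, x); (true, y)] : {set double_cover}) \in S.
  have : ((false, x) : double_cover) \in cover S by rewrite covS inE.
  move=> /bigcupP [e eS xe]; have /edgesP [u [w [uw eE]]] := subsetP sSE _ eS.
  move: xe; rewrite eE !inE => /orP [] /eqP xE; move: uw; rewrite -xE.
    by case: w eE => -[] y eE //; exists y; rewrite xE -eE.
  by case: u eE => -[] y eE //; exists y; rewrite xE setUC -eE.
pose f x := xchoose (ex x).
have fS x : ([set (false, x); (true, f x)] : {set double_cover}) \in S.
  exact: xchooseP (ex x).
have f_inj : injective f.
  move=> x y fxy.
  have mem c : ((true, f c) : double_cover) \in [set (false, c); (true, f c)] by rewrite !inE eqxx orbT.
  have Ex := def_pblock tS (fS x) (mem x).
  have Ey := def_pblock tS (fS y) (mem y).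
  rewrite fxy Ey in Ex; move/setP/(_ (false, y)): Ex.
  by rewrite !inE eqxx /= orbF => /esym /eqP [].
exists (perm f_inj).
  rewrite inE; apply/forallP => x; rewrite permE.
  have /edgesP [u [w [uw eE]]] := subsetP sSE _ (fS x).
  have := congr1 (fun A : {set double_cover} => (false, x) \in A) eE.
  have := congr1 (fun A : {set double_cover} => (true, f x) \in A) eE.
  rewrite !inE !eqxx !orbT /= => /esym /orP [] /eqP Et /esym /orP [] /eqP Ef;
    by move: uw; rewrite -?Et -?Ef //; rewrite -?Et in Ef; case: Ef.
apply/eqP; rewrite eq_sym eqEcard card_imset; last exact: link_inj.
rewrite cardsT cS leqnn andbT; apply/subsetP => _ /imsetP [x _ ->].
by rewrite /link permE.
Qed.

Lemma card_perfect_matchings :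
  #|matchings double_cover #|T| | <= #|compatible|.
Proof.
apply: leq_trans (leq_imset_card (fun s => link s @: setT) compatible).
apply/subset_leq_card/subsetP => S /perfect_matching_links [s sc ->].
exact: imset_f.
Qed.

(** A permutation fixing v is recovered from its links at the other points, and these links form a
    matching. *)
Lemma card_near_perfect_matchings (v : T) :
  #|compatible_off v| <= #|matchings double_cover #|T|.-1|.
Proof.
rewrite -(cardsC1 v).
rewrite -(card_in_imset (f := fun s => link s @: [set~ v])).
  apply/subset_leq_card/subsetP => _ /imsetP [s sv ->].
  move: sv; rewrite inE => /andP [_ /forallP sE]; apply: links_matching => x.
  by rewrite !inE => xv; have := sE x; rewrite xv.
move=> s t; rewrite !inE => /andP [/eqP sv _] /andP [/eqP tv _] st.
apply/permP => x; have [->|xv] := eqVneq x v; first by rewrite sv tv.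
have : link s x \in link t @: [set~ v] by rewrite -st imset_f // !inE.
move=> /imsetP [y _ /setP exy].
have := exy (false, x); rewrite !mem_linkF eqxx => /esym /eqP yx.
by have := exy (true, s x); rewrite !mem_linkT eqxx -yx => /esym /eqP.
Qed.

End DoubleCover.

(** * The ring digraph of degree d = q + 1, with K + 1 blocks on each ring *)

Section RingDigraph.
Variables q K : nat.
Local Notation d := q.+1.
Local Notation ring_pos := ('I_d * 'I_K.+1 * 'I_d)%type.
Local Notation T := (option ring_pos).

(* [None] is the centre and [Some (j, k, l)] is vertex l of block k of ring j. A
   block is a complete digraph with loops, minus the loop at vertex 0; that missing
   loop is replaced by the arcs linking consecutive blocks. *)
Definition ring_next (j : 'I_d) (k : 'I_K.+1) : T :=
  if (k < K)%N then Some (j, inord k.+1, ord0) else None.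

Definition ring_prev (j : 'I_d) (k : 'I_K.+1) : T :=
  if (0 < k)%N then Some (j, inord k.-1, ord0) else None.

(** Numbering the arcs at a vertex by ['I_d] reduces regularity to injectivity of the numbering. At
    vertex 0 of a block, number 0 is the slot of the removed loop and carries the ring arc. *)
Definition out_nbr (x : T) (i : 'I_d) : T :=
  if x is Some (j, k, l) then
    if (l == ord0) && (i == ord0) then ring_next j k else Some (j, k, i)
  else Some (i, ord0, ord0).

Definition in_nbr (x : T) (i : 'I_d) : T :=
  if x is Some (j, k, l) then
    if (l == ord0) && (i == ord0) then ring_prev j k else Some (j, k, i)
  else Some (i, ord_max, ord0).

Definition arc : rel T := fun x y => [exists i, out_nbr x i == y].

(** An arc inside a block is numbered by the vertex at its far end, an arc at the centre by its
    ring, and a ring arc at a block by 0; this identifies its number at either end. *)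
Lemma arc_in_nbr x y : arc x y = [exists i, in_nbr y i == x].
Proof.
apply/existsP/existsP => -[i /eqP <-].
  case: x => [[[j k] l]|] /=; last by exists ord0; rewrite /= /ring_prev ltnn.
  case: ifP => [/andP [/eqP -> _]|li]; last by exists l; rewrite /= andbC li.
  rewrite /ring_next; case: ltnP => kK.
    exists ord0; rewrite /= /ring_prev inordK ?ltnS //=; apply/eqP.
    by congr (Some (_, _, _)); apply: val_inj; rewrite /= inordK.
  exists j => /=; apply/eqP; congr (Some (_, _, _)); apply: val_inj => /=.
  by apply/eqP; rewrite eqn_leq kK -ltnS ltn_ord.
case: y => [[[j k] l]|] /=; last by exists ord0; rewrite /= /ring_next ltnn.
case: ifP => [/andP [/eqP -> _]|li]; last by exists l; rewrite /= andbC li.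
rewrite /ring_prev; case: posnP => k0.
  by exists j; apply/eqP; congr (Some (_, _, _)); apply: val_inj; rewrite /= k0.
have kE : (inord k.-1 : 'I_K.+1) = k.-1 :> nat by rewrite inordK // (leq_ltn_trans (leq_pred _)).
exists ord0; rewrite /= /ring_next kE prednK // -ltnS ltn_ord; apply/eqP.
by congr (Some (_, _, _)); apply: val_inj; rewrite /= ?kE ?prednK // inordK ?prednK.
Qed.

Lemma ring_next_neq j k i : i != ord0 -> ring_next j k != Some (j, k, i).
Proof. by rewrite /ring_next; case: ifP => // _; apply: contraNneq => -[_ ->]. Qed.

Lemma ring_prev_neq j k i : i != ord0 -> ring_prev j k != Some (j, k, i).
Proof. by rewrite /ring_prev; case: ifP => // _; apply: contraNneq => -[_ ->]. Qed.

(** The ring arc ends at the centre or at a vertex 0, hence never at a vertex i != 0 of the same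
    block. *)
Lemma out_nbr_inj x : injective (out_nbr x).
Proof.
case: x => [[[j k] l]|] i i'; last by case.
rewrite /out_nbr /in_nbr; have [_|_] := eqVneq l ord0; last by case.
have [->|i0] := eqVneq i ord0; have [->|i'0] := eqVneq i' ord0 => //=.
- by move=> /eqP; rewrite (negPf (ring_next_neq _ _ i'0)).
- by move=> /esym /eqP; rewrite (negPf (ring_next_neq _ _ i0)).
- by case.
Qed.

Lemma in_nbr_inj x : injective (in_nbr x).
Proof.
case: x => [[[j k] l]|] i i'; last by case.
rewrite /out_nbr /in_nbr; have [_|_] := eqVneq l ord0; last by case.
have [->|i0] := eqVneq i ord0; have [->|i'0] := eqVneq i' ord0 => //=.
- by move=> /eqP; rewrite (negPf (ring_prev_neq _ _ i'0)).
- by move=> /esym /eqP; rewrite (negPf (ring_prev_neq _ _ i0)).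
- by case.
Qed.

Lemma card_arc_out x : #|[set y | arc x y]| = d.
Proof.
rewrite -[RHS]card_ord -cardsT -(card_imset _ (@out_nbr_inj x)); apply: eq_card => y.
by rewrite inE; apply/existsP/imsetP => [[i /eqP <-]|[i _ ->]]; exists i.
Qed.

Lemma card_arc_in y : #|[set x | arc x y]| = d.
Proof.
rewrite -[RHS]card_ord -cardsT -(card_imset _ (@in_nbr_inj y)); apply: eq_card => x.
by rewrite inE arc_in_nbr; apply/existsP/imsetP => [[i /eqP <-]|[i _ ->]]; exists i.
Qed.

Lemma arc_block j k l i : (l != ord0) || (i != ord0) ->
  arc (Some (j, k, l)) (Some (j, k, i)).
Proof. by rewrite -negb_and => /negPf li; apply/existsP; exists i; rewrite /= li. Qed.

(* If block k is entered from outside, it cannot map injectively into itself. *)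
Lemma ring_step (s : {perm T}) j k y : (forall x, arc x (s x)) ->
  s y = Some (j, k, ord0) -> (forall l, y != Some (j, k, l)) ->
  s (Some (j, k, ord0)) = ring_next j k.
Proof.
move=> sE sy yk.
have [i si] := existsP (sE (Some (j, k, ord0))); move: si => /= /eqP.
case: ifP => [_ <- //|/= i0 si].
(* Now s is assumed to keep vertex 0 inside the block. Then s maps the whole block to itself, acting
   as f; f is injective, hence onto, and vertex 0 has a second preimage besides y. *)
pose f l := if s (Some (j, k, l)) is Some (_, _, i') then i' else ord0.
have sf l : s (Some (j, k, l)) = Some (j, k, f l).
  rewrite /f; have [->|l0] := eqVneq l ord0; first by rewrite -si.
  by have /existsP [i' /eqP <-] := sE (Some (j, k, l)); rewrite /= (negPf l0).
have f_inj : injective f.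
  move=> l l' fl; suff: s (Some (j, k, l)) = s (Some (j, k, l')) by move=> /perm_inj [].
  by rewrite !sf fl.
have /imageP [l _ l0] : ord0 \in codom f by rewrite (injF_onto f_inj).
by case/eqP: (yk l); apply: (@perm_inj _ s); rewrite sy sf -l0.
Qed.

(** Induction along the ring: the arc leaving block k enters block k + 1 from outside. *)
Lemma ring_used (s : {perm T}) j : (forall x, arc x (s x)) ->
  s None = Some (j, ord0, ord0) -> forall k, s (Some (j, k, ord0)) = ring_next j k.
Proof.
move=> sE s0 [k kK]; elim: k => [|k IH] in kK *.
  by rewrite (_ : Ordinal kK = ord0); [exact: (ring_step sE s0)|exact: val_inj].
have kK' : (k < K.+1)%N := ltnW kK.
have := IH kK'; rewrite /ring_next /= -ltnS kK => sk; apply: (ring_step (y := Some (j, Ordinal kK', ord0))) => //.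
  by rewrite sk; congr (Some (_, _, _)); apply: val_inj; rewrite /= inordK.
by move=> l; apply/eqP => -[] /eqP; rewrite ltn_eqF.
Qed.

(** The vertices of the cycle running from the centre through ring j. *)
Definition on_ring (j : 'I_d) : {set T} :=
  [set x : T | if x is Some (j', _, l) then (j' == j) && (l == ord0) else true].

(** The set is mapped into itself, hence onto itself by finiteness, so nothing outside is mapped
    into it. *)
Lemma ring_stable (s : {perm T}) j : (forall x, arc x (s x)) ->
  s None = Some (j, ord0, ord0) -> forall x, (s x \in on_ring j) = (x \in on_ring j).
Proof.
move=> sE s0.
have sub : {subset s @: on_ring j <= on_ring j}.
  move=> _ /imsetP [x xj ->]; move: xj; rewrite !inE.
  case: x => [[[j' k] l]|_]; last by rewrite s0 !eqxx.
  move=> /andP [/eqP -> /eqP ->]; rewrite (ring_used sE s0) /ring_next.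
  by case: ifP; rewrite ?eqxx.
have /eqP im : s @: on_ring j == on_ring j.
  by rewrite eqEcard (card_imset _ perm_inj) leqnn andbT; apply/subsetP.
by move=> x; rewrite -{1}im mem_imset //; apply: perm_inj.
Qed.

(** Applied after a successor map that fixes vertex 0 of block k, this transposition inserts 0 just
    before the vertex c k + 1 in the cycle of the latter; [lift] makes that vertex differ from 0. *)
Definition swap (j : 'I_d) (c : {ffun 'I_K.+1 -> 'I_q}) (x : T) : T :=
  if x is Some (j', k, l) then
    if j' == j then Some (j', k, tperm ord0 (lift ord0 (c k)) l) else x
  else x.

Lemma swapK j c : involutive (swap j c).
Proof.
move=> [[[j' k] l]|] //=; case: (eqVneq j' j) => [->|jj] /=.
  by rewrite eqxx tpermK.
by rewrite (negPf jj).
Qed.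

Lemma swap_ring j c k : swap j c (Some (j, k, ord0)) = Some (j, k, lift ord0 (c k)).
Proof. by rewrite /= eqxx tpermL. Qed.

(* Releases the ring vertices from the ring and reinserts each of them in its own
   block, at one of q places: this is the source of the factor q ^ K.+1. *)
Definition reroute (j : 'I_d) (c : {ffun 'I_K.+1 -> 'I_q}) (s : {perm T}) (x : T) : T :=
  swap j c (if x \in on_ring j then x else s x).

Definition through (j : 'I_d) : {set {perm T}} :=
  [set s in compatible arc | s None == Some (j, ord0, ord0)].

Lemma throughP j (s : {perm T}) : s \in through j ->
  (forall x, arc x (s x)) /\ s None = Some (j, ord0, ord0).
Proof. by rewrite !inE => /andP [/forallP sE /eqP s0]. Qed.

Lemma reroute_inj j c s : s \in through j -> injective (reroute j c s).
Proof.
move=> /throughP [sE s0] x y /(inv_inj (@swapK j c)).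
have st := ring_stable sE s0.
have [xj|xj] := boolP (x \in on_ring j); have [yj|yj] := boolP (y \in on_ring j) => //.
- by move=> xy; move: yj; rewrite -(st y) -xy xj.
- by move=> xy; move: xj; rewrite -(st x) xy yj.
- exact: perm_inj.
Qed.

(** Building the permutation takes a proof of injectivity, available on [through j]; elsewhere the
    value s is a default. *)
Definition reroute_perm j c (s : {perm T}) : {perm T} :=
  if decP (@idP (s \in through j)) is left sj then perm (reroute_inj (c := c) sj) else s.

Lemma reroute_permE j c (s : {perm T}) x : s \in through j ->
  reroute_perm j c s x = reroute j c s x.
Proof. by rewrite /reroute_perm; case: decP => // sj _; rewrite permE. Qed.

(** A released ring vertex goes to a nonzero vertex of its block. A nonzero vertex of ring j stays
    in its block, where all targets are allowed. Arcs from the other rings are unchanged. *)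
Lemma reroute_arc j c s x : s \in through j -> x != None -> arc x (reroute j c s x).
Proof.
move=> /throughP [sE s0]; have st := ring_stable sE s0; rewrite /reroute.
case: x => [[[j' k] l]|] // _; case: ifPn => xj.
  move: xj; rewrite inE => /andP [/eqP -> /eqP ->].
  by rewrite swap_ring arc_block.
have := xj; rewrite -st.
have /existsP [i /eqP <-] := sE (Some (j', k, l)).
move: xj; rewrite /out_nbr; have [jj|jj] := eqVneq j' j.
  rewrite jj inE eqxx /= => l0; rewrite (negPf l0) /= eqxx => _.
  by rewrite arc_block ?l0.
rewrite inE (negPf jj) /= => _.
case: ifP => [/andP [/eqP -> _]|li _]; last first.
  by rewrite /= (negPf jj) arc_block // -negb_and li.
move=> nj; have -> : swap j c (ring_next j' k) = ring_next j' k.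
  by move: nj; rewrite /ring_next; case: ifP => //= _ _; rewrite (negPf jj).
by apply/existsP; exists ord0.
Qed.

Lemma reroute_compatible j c s : s \in through j ->
  reroute_perm j c s \in compatible_off arc None.
Proof.
move=> sj; rewrite inE reroute_permE // /reroute inE eqxx /=.
by apply/forallP => x; apply/implyP => x0; rewrite reroute_permE // reroute_arc.
Qed.

(** The images of the ring vertices reveal c; undoing the swap then gives s off the ring, and on the
    ring s is forced by [ring_used]. *)
Lemma reroute_pair_inj j :
  {in setX (through j) [set: {ffun 'I_K.+1 -> 'I_q}] &,
    injective (fun u => reroute_perm j u.2 u.1)}.
Proof.
move=> [s c] [s' c']; rewrite !inE !andbT => sj s'j /= eqr.
have {}sj : s \in through j by rewrite !inE.
have {}s'j : s' \in through j by rewrite !inE.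
have E x : reroute j c s x = reroute j c' s' x by rewrite -!reroute_permE // eqr.
have cc' : c = c'.
  apply/ffunP => k; have := E (Some (j, k, ord0)).
  by rewrite /reroute inE !eqxx !swap_ring => -[ck]; apply: val_inj.
subst c'; congr (_, _); apply/permP => x.
have [sE s0] := throughP sj; have [s'E s'0] := throughP s'j.
have [xj|xj] := boolP (x \in on_ring j); last first.
  by have := E x; rewrite /reroute (negPf xj) => /(inv_inj (@swapK j c)).
move: xj; rewrite inE; case: x => [[[j' k] l]|_]; last by rewrite s0 s'0.
by move=> /andP [/eqP -> /eqP ->]; rewrite (ring_used sE s0) (ring_used s'E s'0).
Qed.

Lemma card_through j : #|through j| * q ^ K.+1 <= #|compatible_off arc None|.
Proof.
have -> : #|through j| * q ^ K.+1 = #|setX (through j) [set: {ffun 'I_K.+1 -> 'I_q}]|.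
  by rewrite cardsX cardsT card_ffun !card_ord.
rewrite -(card_in_imset (@reroute_pair_inj j)).
apply/subset_leq_card/subsetP => _ /imsetP [[s c] /setXP [sj _] ->].
exact: reroute_compatible.
Qed.

(** The centre is left along one of the d rings, so the sets [through j] cover all cycle covers. *)
Lemma card_compatible :
  #|compatible arc| * q ^ K.+1 <= d * #|compatible_off arc None|.
Proof.
have : #|compatible arc| <= \sum_(j < d) #|through j|.
  apply: (@leq_trans #|\bigcup_(j < d) through j|).
    apply/subset_leq_card/subsetP => s sc.
    have /existsP [j /eqP sj] : arc None (s None).
      by move: sc; rewrite inE => /forallP.
    by apply/bigcupP; exists j => //; rewrite !inE -sj eqxx andbT; move: sc; rewrite inE.
  elim/big_rec2: _ => [|j n A _ IH]; first by rewrite cards0.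
  by apply: leq_trans (leq_card_setU _ _) _; rewrite leq_add2l.
move=> /(leq_mul (leqnn (q ^ K.+1))); rewrite mulnC => /leq_trans; apply.
rewrite mulnC big_distrl /= -[X in X * _]card_ord -sum_nat_const.
by apply: leq_sum => j _; exact: card_through.
Qed.

(** The witness rotates every block cyclically; as d >= 2 it avoids the missing loop at vertex 0. *)
Lemma compatible_off_gt0 : 0 < q -> 0 < #|compatible_off arc None|.
Proof.
move=> q0; pose f (x : T) : T := if x is Some (j, k, l) then Some (j, k, ordS l) else None.
have f_inj : injective f.
  move=> [[[j k] l]|] [[[j' k'] l']|] //= [-> -> ll]; congr (Some (_, _, _)).
  by apply: (can_inj (@ordSK _)); apply: val_inj.
apply/card_gt0P; exists (perm f_inj); rewrite inE permE eqxx /=.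
apply/forallP => -[[[j k] l]|]; apply/implyP => // _; rewrite permE /= arc_block //.
have [->|//] := eqVneq l ord0; rewrite -val_eqE /= modn_small //.
Qed.

End RingDigraph.

(** * The ring graphs and the ratio of their top matching numbers *)

Section RingGraph.
Variables q K : nat.

Definition ring_graph : sgraph := double_cover (@arc q K).

Lemma half_nb_vertices_ring_graph :
  half_nb_vertices ring_graph = (q.+1 ^ 2 * K.+1).+1.
Proof.
rewrite half_nb_vertices_double_cover card_option !card_prod !card_ord.
by rewrite mulnAC.
Qed.

Lemma nb_vertices_ring_graph :
  nb_vertices ring_graph = (q.+1 ^ 2 * K.+1).+1.*2.
Proof.
by rewrite -half_nb_vertices_ring_graph half_nb_vertices_double_cover nb_vertices_double_cover.
Qed.

Lemma bipartite_ring_graph : bipartite ring_graph.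
Proof. exact: bipartite_double_cover. Qed.

Lemma regular_ring_graph : regular ring_graph q.+1.
Proof. by apply: regular_double_cover; [exact: card_arc_out|exact: card_arc_in]. Qed.

Lemma near_perfect_matchings_gt0 : 0 < q ->
  0 < #|matchings ring_graph (half_nb_vertices ring_graph).-1|.
Proof.
move=> /(@compatible_off_gt0 q K) /leq_trans; apply.
by rewrite half_nb_vertices_double_cover card_near_perfect_matchings.
Qed.

Lemma card_perfect_near_perfect :
  #|matchings ring_graph (half_nb_vertices ring_graph)| * q ^ K.+1 <=
    q.+1 * #|matchings ring_graph (half_nb_vertices ring_graph).-1|.
Proof.
rewrite half_nb_vertices_double_cover.
apply: leq_trans (leq_mul (card_perfect_matchings _) (leqnn _)) _.
apply: leq_trans (card_compatible _ _) _.
by rewrite leq_mul2l card_near_perfect_matchings orbT.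
Qed.

End RingGraph.

Local Open Scope classical_set_scope.
Local Open Scope ring_scope.

(** * Derivatives of the entropies *)

Section GammaProduct.
Variable R : realType.
Implicit Types (s : seq R) (t g : R).

Definition gamma_prod s : {poly R} := \prod_(g <- s) (1 + g *: 'X).

(** This is t M'/M for M = [gamma_prod s], that is, n p(t). *)
Definition density_sum s t : R := \sum_(g <- s) g * t / (1 + g * t).

Lemma gamma_prod_cons g s : gamma_prod (g :: s) = (1 + g *: 'X) * gamma_prod s.
Proof. by rewrite /gamma_prod big_cons. Qed.

Lemma gamma_factor_gt0 g t : 0 <= g -> 0 <= t -> 0 < 1 + g * t.
Proof. by move=> g0 t0; rewrite ltr_pwDl // mulr_ge0. Qed.

Lemma size_gamma_prod s : (size (gamma_prod s) <= (size s).+1)%N.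
Proof.
elim: s => [|g s IH]; first by rewrite /gamma_prod big_nil size_poly1.
rewrite gamma_prod_cons; apply: leq_trans (size_polyMleq _ _) _.
have s2 : (size (1 + g *: 'X : {poly R})%R <= 2)%N.
  rewrite (leq_trans (size_polyD _ _)) // geq_max size_poly1 /=.
  by rewrite (leq_trans (size_scale_leq _ _)) // size_polyX.
by move: (leq_add s2 IH); case: (_ + _)%N.
Qed.

Lemma coef_gamma_prod_cons g s k :
  (gamma_prod (g :: s))`_k.+1 = (gamma_prod s)`_k.+1 + g * (gamma_prod s)`_k.
Proof. by rewrite gamma_prod_cons mulrDl mul1r -scalerAl coefD coefZ coefXM. Qed.

Lemma lead_gamma_prod s : (gamma_prod s)`_(size s) = \prod_(g <- s) g.
Proof.
elim: s => [|g s IH]; first by rewrite /gamma_prod !big_nil coef1.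
by rewrite coef_gamma_prod_cons IH big_cons nth_default ?add0r // size_gamma_prod.
Qed.

Lemma lead_gamma_prod_cons g s :
  (gamma_prod (g :: s))`_(size s).+1 = g * (gamma_prod s)`_(size s).
Proof. by rewrite coef_gamma_prod_cons nth_default ?add0r // size_gamma_prod. Qed.

(** The coefficients are elementary symmetric functions: each of the k + 1 terms of the k-th one
    omits a single factor, which is at least a. *)
Lemma le_gamma_coef a s k : 0 <= a -> {in s, forall g, a <= g} -> size s = k.+1 ->
  a * (gamma_prod s)`_k <= k.+1%:R * (gamma_prod s)`_k.+1.
Proof.
move=> a0; elim: k s => [|k IH] [|g s] // ag [sk].
  rewrite (size0nil sk) /gamma_prod big_seq1 !coefD !coef1 !coefZ !coefX /=.
  by rewrite mulr0 addr0 mulr1 add0r mulr1 mul1r ag ?mem_head.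
have as' : {in s, forall g, a <= g} by move=> x xs; apply: ag; rewrite inE xs orbT.
have {}ag : a <= g by apply: ag; rewrite mem_head.
rewrite coef_gamma_prod_cons -sk lead_gamma_prod_cons sk.
have P0 : 0 <= (gamma_prod s)`_k.+1.
  rewrite -sk lead_gamma_prod big_seq prodr_ge0 // => x /as'.
  exact: le_trans.
rewrite mulrDr [k.+2%:R]mulrS mulrDl mul1r lerD ?ler_wpM2r //.
by rewrite mulrCA [_ * (g * _)]mulrCA ler_wpM2l ?IH // (le_trans a0).
Qed.

Lemma horner_gamma_prod s t : (gamma_prod s).[t] = \prod_(g <- s) (1 + g * t).
Proof. by rewrite horner_prod; apply: eq_bigr => g _; rewrite !hornerE. Qed.

Lemma horner_gamma_prod_gt0 s t : all (>= 0) s -> 0 <= t -> 0 < (gamma_prod s).[t].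
Proof.
move=> s0 t0; rewrite horner_gamma_prod big_seq prodr_gt0 // => g /(allP s0) g0.
exact: gamma_factor_gt0.
Qed.

Lemma log_deriv_gamma_prod s t : all (>= 0) s -> 0 <= t ->
  t * (deriv (gamma_prod s)).[t] = (gamma_prod s).[t] * density_sum s t.
Proof.
move=> s0 t0; elim: s s0 => [|g s IH] /=.
  by rewrite /gamma_prod /density_sum !big_nil -polyC1 derivC horner0 !mulr0.
move=> /andP [g0 /IH {}IH]; rewrite gamma_prod_cons derivM.
have -> : deriv (1 + g *: 'X) = g%:P :> {poly R}.
  by rewrite derivD -polyC1 derivC add0r derivZ derivX -mul_polyC mulr1.
rewrite !hornerE; transitivity
  (t * g * (gamma_prod s).[t] + (1 + g * t) * (t * (deriv (gamma_prod s)).[t])).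
  by ring.
rewrite IH /density_sum big_cons.
by have := gamma_factor_gt0 g0 t0; move=> /lt0r_neq0 h; field.
Qed.

Lemma ln_gamma_prod s t : all (>= 0) s -> 0 <= t ->
  ln (gamma_prod s).[t] = \sum_(g <- s) ln (1 + g * t).
Proof.
move=> + t0; elim: s => [|g s IH] /=.
  by rewrite /gamma_prod !big_nil hornerC ln1.
move=> /andP [g0 s0]; rewrite gamma_prod_cons big_cons hornerM lnM.
- by rewrite IH // !hornerE.
- by rewrite !hornerE posrE gamma_factor_gt0.
- by rewrite posrE horner_gamma_prod_gt0.
Qed.

Lemma is_derive_sum_seq (f : R -> R -> R) (f' : R -> R) s t :
  {in s, forall g, is_derive t 1 (f g) (f' g)} ->
  is_derive t 1 (fun u => \sum_(g <- s) f g u) (\sum_(g <- s) f' g).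
Proof.
elim: s => [|g s IH] h.
  rewrite big_nil; under eq_fun do rewrite big_nil; exact: is_derive_cst.
rewrite big_cons; under eq_fun do rewrite big_cons.
apply: is_deriveD; first by apply: h; rewrite mem_head.
by apply: IH => x xs; apply: h; rewrite inE xs orbT.
Qed.

Lemma is_derive_affine g t : is_derive t 1 (fun u : R => 1 + g * u) g.
Proof. by apply: is_derive_eq; rewrite add0r mul1r /GRing.scale /= mulr1. Qed.

Lemma is_derive_density_sum s t : all (>= 0) s -> 0 <= t ->
  is_derive t 1 (density_sum s) (\sum_(g <- s) g / (1 + g * t) ^+ 2).
Proof.
move=> s0 t0; apply: is_derive_sum_seq => g /(allP s0) g0.
have h : 1 + g * t != 0 by rewrite gt_eqF // gamma_factor_gt0.
have da := is_derive_affine g t.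
have dv := @is_deriveV _ (fun u => 1 + g * u) t _ _ h da.
apply: is_derive_eq; rewrite /GRing.scale /=; field.
by rewrite h.
Qed.

Lemma is_derive_ln_sum s t : all (>= 0) s -> 0 <= t ->
  is_derive t 1 (fun u => \sum_(g <- s) ln (1 + g * u)) (\sum_(g <- s) g / (1 + g * t)).
Proof.
move=> s0 t0; apply: is_derive_sum_seq => g /(allP s0) g0.
have h : 0 < 1 + g * t by rewrite gamma_factor_gt0.
have dl := is_derive1_ln h.
have da := is_derive_affine g t.
have := @is_derive1_comp R (@ln R) (fun u => 1 + g * u) t _ _ dl da.
by rewrite mulrC.
Qed.

Lemma density_sum_inj s : all (>= 0) s -> has (> 0) s ->
  {in [pred t | 0 <= t] &, injective (density_sum s)}.
Proof.
move=> s0 sp.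
suff H x y : 0 <= x -> x < y -> density_sum s x < density_sum s y.
  move=> x y; rewrite !inE => x0 y0 xy; have [lt_xy|lt_yx|//] := ltgtP x y.
    by have := H _ _ x0 lt_xy; rewrite xy ltxx.
  by have := H _ _ y0 lt_yx; rewrite xy ltxx.
move=> x0 xy; have y0 := le_trans x0 (ltW xy).
(* Summands with g = 0 are constant, so one positive g is what makes the sum strictly increasing. *)
have mono g : 0 <= g -> g * x / (1 + g * x) <= g * y / (1 + g * y) ?= iff (g == 0).
  move=> g0; have hx := gamma_factor_gt0 g0 x0; have hy := gamma_factor_gt0 g0 y0.
  have e : g * y / (1 + g * y) - g * x / (1 + g * x) = g * (y - x) / ((1 + g * y) * (1 + g * x)).
    by field; rewrite !gt_eqF.
  split.
    by rewrite -subr_ge0 e divr_ge0 ?mulr_ge0 // ?subr_ge0 ltW.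
  rewrite eq_sym -subr_eq0 e !mulf_eq0 invr_eq0 mulf_eq0 subr_eq0.
  by rewrite (gt_eqF xy) (gt_eqF hx) (gt_eqF hy) !orbF.
elim: s s0 sp => //= g s IH /andP [g0 s0] /orP [gp|sp]; rewrite /density_sum !big_cons.
  apply: ltr_leD.
    by rewrite lt_neqAle (mono g g0) (gt_eqF gp) (mono g g0).
  rewrite !big_seq; apply: ler_sum => a /(allP s0) a0.
  by rewrite (mono a a0).
by apply: ler_ltD; [rewrite (mono g g0)|exact: IH].
Qed.

End GammaProduct.

(** * Derivative of the Bethe entropy *)

Section BetheDerivative.
Variables (R : realType) (d : nat).

(** The non-logarithmic contributions of the three terms, -1, -1 and 2, cancel. *)
Lemma is_derive_bethe_entropy (p : R) : 0 < p -> p < 1 -> (0 < d)%N ->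
  is_derive p 1 (bethe_entropy d : R -> R)
    (2^-1 * (ln (d%:R / p) - ln (1 - p / d%:R) + 2 * ln (1 - p))).
Proof.
move=> p0 p1 d0; have d1 : 1 <= d%:R :> R by rewrite ler1n.
have dp : 0 < d%:R :> R by rewrite ltr0n.
have pd : p < d%:R := lt_le_trans p1 d1.
have x1 : 0 < d%:R / p by rewrite divr_gt0.
have x2 : 0 < 1 - p / d%:R by rewrite subr_gt0 ltr_pdivrMr ?mul1r.
have x3 : 0 < 1 - p by rewrite subr_gt0.
have l1 := is_derive1_ln x1; have l2 := is_derive1_ln x2; have l3 := is_derive1_ln x3.
have e1 : is_derive p 1 (fun u : R => d%:R / u) (- d%:R / p ^+ 2).
  have v := @is_deriveV R id p 1 1 (lt0r_neq0 p0) (is_derive_id _ _).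
  apply: is_derive_eq; rewrite /GRing.scale /=; field; exact: lt0r_neq0.
have e2 : is_derive p 1 (fun u : R => 1 - u / d%:R) (- d%:R^-1).
  by apply: is_derive_eq; rewrite /GRing.scale /= ; field; exact: lt0r_neq0.
have e3 : is_derive p 1 (fun u : R => 1 - u) (- 1).
  by apply: is_derive_eq; rewrite add0r mul1r.
have c1 := @is_derive1_comp R (@ln R) _ p _ _ l1 e1.
have c2 := @is_derive1_comp R (@ln R) _ p _ _ l2 e2.
have c3 := @is_derive1_comp R (@ln R) _ p _ _ l3 e3.
rewrite /bethe_entropy.
apply: is_derive_eq; rewrite /GRing.scale /=.
field; rewrite !lt0r_neq0 //= subr_gt0 //.
Qed.

End BetheDerivative.

(** * Derivatives of the density, the entropy and the gap *)

Section EntropyDerivative.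
Variables (R : realType) (G : sgraph) (s : seq R).
Hypotheses (Gs : gammas G s) (s_ge0 : all (>= 0) s) (s_pos : has (> 0) s).
Hypothesis vG : nb_vertices G = (half_nb_vertices G).*2.
Local Notation n := (half_nb_vertices G).

Let match_polyE : match_poly R G = gamma_prod s.
Proof. by case: Gs. Qed.

Lemma half_nb_vertices_gt0 : (0 < n)%N.
Proof. by case: Gs => <- _ _; case: s s_pos. Qed.

Let n_gt0 : 0 < n%:R :> R.
Proof. by rewrite ltr0n half_nb_vertices_gt0. Qed.

Lemma match_densityE (t : R) : 0 <= t -> match_density G t = n%:R^-1 * density_sum s t.
Proof.
move=> t0; rewrite /match_density match_polyE log_deriv_gamma_prod //.
have h := lt0r_neq0 (horner_gamma_prod_gt0 s_ge0 t0).
by field; rewrite h lt0r_neq0.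
Qed.

Lemma match_density_inj : {in [set t : R | 0 <= t] &, injective (match_density G)}.
Proof.
move=> t u /set_mem /= t0 /set_mem /= u0; rewrite !match_densityE // => tu.
apply: (density_sum_inj s_ge0 s_pos) => //.
by apply: (mulfI _ tu); rewrite invr_neq0 // lt0r_neq0.
Qed.

(** By injectivity, [pinv] undoes the density at every value p = p(t); the entropy is differentiated
    at such values. *)
Lemma activityK (t : R) : 0 <= t -> activity G (match_density G t) = t.
Proof.
by move=> t0; exact: (@pinvKV _ _ _ _ _ match_density_inj t (mem_set t0)).
Qed.

(** This is n p'(t). *)
Definition density_slope (t : R) : R := \sum_(g <- s) g / (1 + g * t) ^+ 2.

Lemma density_slope_gt0 (t : R) : 0 <= t -> 0 < density_slope t.
Proof.
move=> t0; have h g : 0 <= g -> 0 <= g / (1 + g * t) ^+ 2.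
  by move=> g0; rewrite divr_ge0 // sqr_ge0.
rewrite /density_slope; elim: s s_ge0 s_pos => //= g r IH /andP [g0 r0] /orP [gp|rp].
  rewrite big_cons ltr_pwDl //; first by rewrite divr_gt0 // exprn_gt0 // gamma_factor_gt0.
  by rewrite big_seq sumr_ge0 // => a /(allP r0) /h.
by rewrite big_cons ltr_wpDl ?h ?IH.
Qed.

Lemma is_derive_match_density (t : R) : 0 < t ->
  is_derive t 1 (match_density G : R -> R) (n%:R^-1 * density_slope t).
Proof.
move=> t0; have ds := is_derive_density_sum s_ge0 (ltW t0).
apply: (near_eq_is_derive (f := n%:R^-1 \*: density_sum s)).
  by near=> u; rewrite match_densityE // ltW //; near: u; exact: lt_nbhsr.
Unshelve. all: by end_near. Qed.

(** As v(G) = 2n, the derivative of ln M / v(G) is p / (2t). It cancels against the derivative of ln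
    t, leaving -1/2 p' ln t. *)
Lemma is_derive_free_entropy (t : R) : 0 < t ->
  is_derive t 1 (free_entropy G : R -> R) (- 2^-1 * (n%:R^-1 * density_slope t) * ln t).
Proof.
move=> t0; have dl := is_derive_ln_sum s_ge0 (ltW t0).
have dm := is_derive_match_density t0.
have dln := is_derive1_ln t0.
apply: (near_eq_is_derive (f := fun u => (n.*2)%:R^-1 * (\sum_(g <- s) ln (1 + g * u)) -
   2^-1 * (match_density G u * ln u))).
  near=> u; have u0 : 0 < u by near: u; exact: lt_nbhsr.
  rewrite /free_entropy gt_eqF // match_polyE ln_gamma_prod ?(ltW u0) // vG.
  by rewrite [X in X - _]mulrC mulrA.
apply: is_derive_eq; rewrite match_densityE ?(ltW t0) // /GRing.scale /=.
rewrite -mul2n natrM.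
have -> : density_sum s t = t * \sum_(g <- s) g / (1 + g * t).
  by rewrite mulr_sumr; apply: eq_bigr => g _; rewrite [g * t]mulrC mulrA.
by field; rewrite lt0r_neq0 //= lt0r_neq0.
Unshelve. all: by end_near. Qed.

Lemma match_density_compl (t : R) : 0 <= t ->
  1 - match_density G t = n%:R^-1 * \sum_(g <- s) (1 + g * t)^-1.
Proof.
move=> t0; rewrite match_densityE //.
have -> : \sum_(g <- s) (1 + g * t)^-1 = n%:R - density_sum s t.
  apply/eqP; rewrite eq_sym subr_eq eq_sym; apply/eqP.
  have [<- _ _] := Gs; rewrite /density_sum -big_split /=.
  transitivity (\sum_(g <- s) (1 : R)); last first.
    by rewrite big_const_seq count_predT iter_addr_0.
  rewrite big_seq [RHS]big_seq; apply: eq_bigr => g /(allP s_ge0) g0.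
  by field; rewrite lt0r_neq0 // gamma_factor_gt0.
by field; rewrite lt0r_neq0.
Qed.

Lemma inv_gamma_factor_gt0 (t : R) g : 0 <= t -> g \in s -> 0 < (1 + g * t)^-1.
Proof. by move=> t0 /(allP s_ge0) g0; rewrite invr_gt0 gamma_factor_gt0. Qed.

Lemma match_density_compl_ge (t g : R) : 0 <= t -> g \in s ->
  n%:R^-1 * (1 + g * t)^-1 <= 1 - match_density G t.
Proof.
move=> t0 gs; rewrite match_density_compl // ler_wpM2l ?invr_ge0 ?(ltW n_gt0) //.
rewrite (perm_big _ (perm_to_rem gs)) big_cons lerDl big_seq sumr_ge0 // => a.
by move=> /mem_rem /(inv_gamma_factor_gt0 t0) /ltW.
Qed.

Lemma match_density_lt1 (t : R) : 0 <= t -> match_density G t < 1.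
Proof.
move=> t0; have [g gs _] := hasP s_pos; rewrite -subr_gt0.
apply: lt_le_trans (match_density_compl_ge t0 gs).
by rewrite mulr_gt0 ?invr_gt0 // -invr_gt0 inv_gamma_factor_gt0.
Qed.

Lemma match_density_gt0 (t : R) : 0 < t -> 0 < match_density G t.
Proof.
move=> t0; have t0' := ltW t0.
rewrite match_densityE // mulr_gt0 ?invr_gt0 // /density_sum.
have h g : 0 <= g -> 0 <= g * t / (1 + g * t).
  by move=> g0; rewrite divr_ge0 ?mulr_ge0 // ltW // gamma_factor_gt0.
have [g gs gp] := hasP s_pos; rewrite (perm_big _ (perm_to_rem gs)) big_cons.
rewrite ltr_pwDl //; first by rewrite divr_gt0 ?mulr_gt0 // gamma_factor_gt0 // ltW.
by rewrite big_seq sumr_ge0 // => a /mem_rem /(allP s_ge0) /h.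
Qed.

(** Chain rule with the inverse function t(p), whose derivative is 1 / p'(t): the factor p'(t) of
    F'(t) cancels. *)
Lemma is_derive_entropy (t : R) : 0 < t ->
  is_derive (match_density G t) 1 (entropy G : R -> R) (- 2^-1 * ln t).
Proof.
move=> t0; set p := match_density G t.
have dm := is_derive_match_density t0.
have slope0 : n%:R^-1 * density_slope t != 0.
  by rewrite mulf_neq0 ?invr_neq0 ?lt0r_neq0 // density_slope_gt0 // ltW.
have da : is_derive p 1 (activity G : R -> R) (n%:R^-1 * density_slope t)^-1.
  apply: (@is_derive_inverse R (match_density G) (activity G) _ t) => //.
    near=> u; apply/activityK/ltW; near: u; exact: lt_nbhsr.
  near=> u; have u0 : 0 < u by near: u; exact: lt_nbhsr.
  have du := is_derive_match_density u0.
  apply: differentiable_continuous; apply/derivable1_diffP; exact: ex_derive.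
have at_p : activity G p = t by rewrite activityK // ltW.
have df : is_derive (activity G p) 1 (free_entropy G : R -> R) (- 2^-1 * (n%:R^-1 * density_slope t) * ln t).
  by rewrite at_p; exact: is_derive_free_entropy.
(* As p(t) < 1, the limit branch of [entropy] is avoided near p(t). *)
apply: (near_eq_is_derive (f := fun q => free_entropy G (activity G q))).
  near=> q; rewrite /entropy ifT //; near: q; apply: lt_nbhsl.
  exact: match_density_lt1 (ltW t0).
have := @is_derive1_comp R (free_entropy G) (activity G) p _ _ df da.
by congr (is_derive _ _ _ _); field; rewrite lt0r_neq0 //= lt0r_neq0 // density_slope_gt0 // ltW.
Unshelve. all: by end_near. Qed.

(** The derivative is -1/2 times the sum of ln (d/p) > 0, -ln (1 - p/d) > 0 and ln (t (1-p)^2) >=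
    0. *)
Lemma entropy_gap_derive_lt0 (d : nat) (t : R) : (0 < d)%N -> 0 < t ->
  let p := match_density G t in 1 <= t * (1 - p) ^+ 2 ->
  derivable (entropy_gap G d : R -> R) p 1 /\ derive1 (entropy_gap G d : R -> R) p < 0.
Proof.
move=> d0 t0 p tp.
have p0 : 0 < p by apply: match_density_gt0.
have p1 : p < 1 by apply/match_density_lt1/ltW.
have dE := is_derive_entropy t0.
have dB := is_derive_bethe_entropy p0 p1 d0.
have dG : is_derive p 1 (entropy_gap G d : R -> R) _ := is_deriveB dE dB.
split; first exact: ex_derive.
rewrite derive1E derive_val.
have dp : 0 < d%:R :> R by rewrite ltr0n.
have d1 : 1 <= d%:R :> R by rewrite ler1n.
have l1 : 0 < ln (d%:R / p) by rewrite ln_gt0 // ltr_pdivlMr ?mul1r // (lt_le_trans p1).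
have l2 : ln (1 - p / d%:R) < 0.
  rewrite ln_lt0 // subr_gt0 ltr_pdivrMr ?mul1r // (lt_le_trans p1) //=.
  by rewrite ltrBlDr ltrDl divr_gt0.
have l3 : 0 <= ln t + 2 * ln (1 - p).
  have q0 : 0 < 1 - p by rewrite subr_gt0.
  have := ln_ge0 tp; rewrite lnM ?posrE ?exprn_gt0 //.
  by rewrite lnXn // mulr_natl.
lra.
Qed.

End EntropyDerivative.

(** * The smallest gamma of a ring graph *)

(** With a = m + 1 one has n <= a^4, so the left side is at most a^14 < a^16 <= (2^m)^16. This bound
    absorbs all factors polynomial in n and d. *)
Lemma cube_lt_expn (d m n : nat) : (d + 32 <= m)%N ->
  n = (d ^ 2 * (32 * m)).+1%N -> (4 * n ^ 3 * d < 2 ^ (16 * m))%N.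
Proof.
move=> dm nE; set a := m.+1.
have a32 : (33 <= a)%N by rewrite /a; lia.
have na : (n <= a ^ 4)%N.
  have h1 : (d ^ 2 * (32 * m) <= m * (m * (32 * m)))%N.
    by rewrite [leqRHS]mulnA leq_mul // -mulnn leq_mul //; lia.
  rewrite nE /a !expnS expn0; nia.
have m2 : (a <= 2 ^ m)%N by rewrite /a ltn_expl.
apply: (@leq_ltn_trans (a * (a ^ 4) ^ 3 * a)).
  apply: leq_mul; last by rewrite /a; lia.
  apply: leq_mul; [lia|by rewrite leq_exp2r].
rewrite -expnM -expnS -expnSr (leq_trans (_ : (_ < a ^ 16)%N)) //.
  by rewrite ltn_exp2l; lia.
by rewrite mulnC expnM leq_exp2r.
Qed.

Lemma bernoulli_ineq (R : realFieldType) (x : R) (k : nat) : 0 <= x <= 1 -> 1 - k%:R * x <= (1 - x) ^+ k.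
Proof.
move=> /andP [x0 x1]; elim: k => [|k IH]; first by rewrite mul0r subr0 expr0.
rewrite exprS mulrS; apply: le_trans (ler_wpM2l _ IH); last by rewrite subr_ge0.
by have := ler0n R k => k0; nra.
Qed.

(** * Exponential smallness of the least gamma *)

Section SmallestGamma.
Variables (R : realType) (q K : nat).
Hypothesis q2 : (2 <= q)%N.
Local Notation H := (ring_graph q K).
Local Notation n := (half_nb_vertices H).

Lemma coef_match_poly (G : sgraph) k : (k <= half_nb_vertices G)%N ->
  (match_poly R G)`_k = #|matchings G k|%:R.
Proof. by move=> kn; rewrite coef_poly ltnS kn. Qed.

Variable s : seq R.
Hypotheses (Gs : gammas H s) (s_ge0 : all (>= 0) s).

Lemma near_perfect_gt0 : 0 < (#|matchings H n.-1|%:R : R).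
Proof. by rewrite ltr0n near_perfect_matchings_gt0 // ltnW. Qed.

(** If all gammas vanished, the matching polynomial would be 1, but m_(n-1) > 0 and n - 1 > 0. *)
Lemma has_gamma_gt0 : has (> 0) s.
Proof.
apply: contraPT (near_perfect_gt0) => /hasPn sn.
have [_ _ M] := Gs.
rewrite -coef_match_poly ?leq_pred // M big1_seq => [|g /andP [_ gs]].
  by rewrite half_nb_vertices_ring_graph /= coef1 muln_eq0 expn_eq0 /= ltxx.
have g0 : g = 0 by apply/eqP; rewrite eq_le (allP s_ge0) // andbT leNgt sn.
by rewrite g0 scale0r addr0.
Qed.

(** Combines g1 m_(n-1) <= n m_n with m_n q^(K+1) <= d m_(n-1), where q >= 2, and cancels m_(n-1) >
    0. *)
Lemma min_gamma_le g1 : {in s, forall g, g1 <= g} -> 0 <= g1 ->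
  g1 * 2 ^+ K.+1 <= n%:R * q.+1%:R.
Proof.
move=> gmin g0; have [sz _ M] := Gs.
have nS : n = n.-1.+1 by rewrite half_nb_vertices_ring_graph.
have := le_gamma_coef g0 gmin (etrans sz nS).
rewrite /gamma_prod -M -nS !coef_match_poly ?leq_pred // => h1.
have h2 : #|matchings H n|%:R * 2 ^+ K.+1 <= q.+1%:R * #|matchings H n.-1|%:R :> R.
  rewrite -natrX -!natrM ler_nat; apply: leq_trans (card_perfect_near_perfect q K).
  by rewrite leq_mul2l leq_exp2r // q2 orbT.
rewrite -(ler_pM2r near_perfect_gt0) mulrAC.
apply: le_trans (ler_wpM2r _ h1) _; first by rewrite exprn_ge0.
by rewrite -!mulrA ler_wpM2l.
Qed.

End SmallestGamma.

(** With 32 m blocks per ring, gamma_1 <= n d / 2^(32 m). Half of the exponent absorbs n d < 2^(16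
    m), so gamma_1 < 2^(-16 m), while v(H) is at most 128 d^2 m. *)
Lemma ring_graph_properties (R : realType) (q m : nat) :
  (2 <= q)%N -> (q.+1 + 32 <= m)%N ->
  let H := ring_graph q (32 * m).-1 in
  let c : R := 1 - (16 * q.+1 ^ 2)%:R^-1 in
  (exists s : seq R, exists2 g1 : R,
    gammas H (g1 :: s) & g1 < c ^+ nb_vertices H) /\
  (exists p0 : R,
    [/\ 0 < p0 < 1, derivable (fun p : R => entropy_gap H q.+1 p) p0 1 &
        derive1 (fun p : R => entropy_gap H q.+1 p) p0 < 0]).
Proof.
move=> q2 qm H c.
have KE : (32 * m).-1.+1 = (32 * m)%N by rewrite prednK //; lia.
have [s Gs s0] := Heilmann_Lieb R H.
have sp := has_gamma_gt0 q2 Gs s0.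
case: s Gs s0 sp => // g1 s Gs s0 sp.
pose n := half_nb_vertices H.
have nE : n = (q.+1 ^ 2 * (32 * m)).+1 by rewrite /n half_nb_vertices_ring_graph KE.
have vE : nb_vertices H = n.*2 by rewrite nb_vertices_ring_graph /n half_nb_vertices_ring_graph.
have g0 : 0 <= g1 by have /andP [] := s0.
have gmin : {in g1 :: s, forall g, g1 <= g}.
  have [_ so _] := Gs => g; rewrite inE => /orP [/eqP -> //|gs].
  by move/(order_path_min le_trans)/allP: so; apply.
have small := min_gamma_le q2 Gs gmin g0.
have big := cube_lt_expn qm nE.
rewrite -/n KE in small.
have n0 : 0 < n%:R :> R by rewrite nE ltr0n.
have bigR : 4 * n%:R ^+ 3 * q.+1%:R < 2 ^+ (16 * m) :> R.
  by rewrite -natrX -natrM -natrM -natrX ltr_nat.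
pose x : R := (16 * q.+1 ^ 2)%:R^-1.
have x01 : 0 <= x <= 1.
  by rewrite /x invr_ge0 ler0n invf_le1 ?ler1n ?ltr0n.
split.
  exists s, g1 => //.
  pose e : R := 2 ^+ (32 * m).
  have e0 : 0 < e by rewrite exprn_gt0.
  rewrite -(ltr_pM2r e0); apply: le_lt_trans small _.
  have nd : n%:R * q.+1%:R < 2 ^+ (16 * m) :> R.
    rewrite -natrX -natrM ltr_nat; apply: leq_ltn_trans big.
    by rewrite leq_mul2r /= expnSr mulnA leq_pmull // muln_gt0 expn_gt0 nE.
  apply: lt_le_trans nd _.
  have sq2 : 2 <= (3 / 4 * 2 : R) ^+ 2 by clear; lra.
  (* The constant 16 in c is chosen so that (2 * 3 / 4) ^ 2 >= 2. *)
  have c3 : 3 / 4 <= c ^+ (4 * q.+1 ^ 2).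
    apply: le_trans (bernoulli_ineq _ x01).
    rewrite /x !natrM; have : (q.+1 ^ 2)%:R != 0 :> R by rewrite pnatr_eq0 expn_eq0.
    by move=> ?; rewrite invfM mulrACA mulfV // mulr1; lra.
  (* The factor 4 in place of 2 absorbs the centre, the + 1 in n. *)
  have le_n : (n.*2 <= 4 * q.+1 ^ 2 * (32 * m))%N.
    have X0 : (0 < q.+1 ^ 2 * (32 * m))%N by rewrite muln_gt0 expn_gt0 /= -KE.
    by rewrite nE -mulnA; clear -X0; lia.
  have c_n : (3 / 4) ^+ (32 * m) <= c ^+ nb_vertices H.
    rewrite vE; apply: le_trans (ler_wiXn2l _ _ le_n); last 2 first.
    - by rewrite /c subr_ge0; case/andP: x01.
    - by rewrite /c gerBl; case/andP: x01.
    by rewrite [leRHS]exprM lerXn2r // ?nnegrE ?exprn_ge0 // subr_ge0; case/andP: x01.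
  apply: le_trans (ler_wpM2r (ltW e0) c_n); rewrite /e -exprMn.
  rewrite (_ : 32 * m = 2 * (16 * m))%N; last by rewrite mulnA.
  by rewrite [leRHS]exprM lerXn2r ?nnegrE // exprn_ge0 ?mulr_ge0.
(* This is gamma_1 t <= 1 for the t chosen below, so the summand 1 / (1 + gamma_1 t) is at least
   1/2. *)
have small' : g1 * (4 * n%:R ^+ 2) <= 1.
  have e0 : 0 < 2 ^+ (32 * m) :> R by rewrite exprn_gt0.
  rewrite -(ler_pM2r e0) mul1r mulrAC.
  apply: le_trans (ler_wpM2r _ small) _; first by rewrite mulr_ge0 ?sqr_ge0.
  rewrite [leLHS](_ : _ = 4 * n%:R ^+ 3 * q.+1%:R); last by ring.
  by apply/ltW/(lt_le_trans bigR); rewrite ler_weXn2l ?ler1n // leq_mul2r orbT.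
pose t : R := 4 * n%:R ^+ 2.
have t0 : 0 < t by rewrite mulr_gt0 ?exprn_gt0.
pose p := match_density H t.
have p_compl : (2 * n%:R)^-1 <= 1 - p.
  apply: le_trans (match_density_compl_ge Gs s0 sp (ltW t0) (mem_head g1 s)).
  rewrite invfM mulrC ler_pM2l ?invr_gt0 // lef_pV2 ?posrE ?gamma_factor_gt0 ?(ltW t0) //.
  by rewrite -/t in small'; lra.
have tp : 1 <= t * (1 - p) ^+ 2.
  have i0 : 0 <= (2 * n%:R : R)^-1 by rewrite invr_ge0 mulr_ge0.
  have sq := lerXn2r 2 (i0 : _ \in Num.nneg) (le_trans i0 p_compl : _ \in Num.nneg) p_compl.
  apply: le_trans (ler_wpM2l (ltW t0) sq).
  by rewrite [leRHS](_ : _ = 1) // /t; field; rewrite lt0r_neq0.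
exists p; split.
- by rewrite (match_density_gt0 Gs s0 sp t0) (match_density_lt1 Gs s0 sp (ltW t0)).
- by have [] := entropy_gap_derive_lt0 Gs s0 sp vE (ltn0Sn q) t0 tp.
- by have [] := entropy_gap_derive_lt0 Gs s0 sp vE (ltn0Sn q) t0 tp.
Qed.

Theorem proposition5p4 (R : realType) (d : nat) (hd : (3 <= d)%N) :
  exists (H : nat -> sgraph) (c : R),
    [/\ forall i : nat,
          [/\ (0 < nb_vertices (H i))%N, regular (H i) d & bipartite (H i)],
        (fun i : nat => nb_vertices (H i)) @ \oo --> \oo,
        0 < c < 1,
        forall i : nat, exists s : seq R,
          exists2 g1 : R, gammas (H i) (g1 :: s) & g1 < c ^+ nb_vertices (H i) &
        forall i : nat, exists p0 : R,
          [/\ 0 < p0 < 1,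
              derivable (fun p : R => entropy_gap (H i) d p) p0 1 &
              derive1 (fun p : R => entropy_gap (H i) d p) p0 < 0]].
Proof.
case: d hd => // q q2.
(* The offset d + 32 meets the size condition for every i, while c depends on d alone. *)
pose m i := (q.+1 + 32 + i)%N.
exists (fun i => ring_graph q (32 * m i).-1), (1 - (16 * q.+1 ^ 2)%:R^-1).
have props i := ring_graph_properties R q2 (leq_addr i (q.+1 + 32)).
split.
- move=> i; split; [|exact: regular_ring_graph|exact: bipartite_ring_graph].
  by rewrite nb_vertices_ring_graph.
- apply/cvgnyPge => A; near=> i; rewrite nb_vertices_ring_graph.
  have Ai : (A <= i)%N by near: i; exact: nbhs_infty_ge.
  rewrite prednK /m //; last by lia.
- have c16 : (16 <= 16 * q.+1 ^ 2)%N by rewrite leq_pmulr // expn_gt0.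
  rewrite subr_gt0 ltrBlDr ltrDl invr_gt0 invf_lt1 ?ltr0n ?ltr1n ?(leq_trans _ c16) //.
- by move=> i; have [] := props i.
- by move=> i; have [] := props i.
Unshelve. all: by end_near. Qed.
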